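(* Suppose that for each cell $I_i$ there is a quadrature rule $Q_i^k(v)=\sum_{j=0}^{k+1}A_{i,j}v(x_{i,j})$ on the subdivision points satisfying (1) $\int_{I_i}v\,dx=Q_i^k(v)$ for all $v\in\mathbb P^{2k-1}(I_i)$ and (2) $\frac{h_i}{2k-1}-Q_i^k(L_{i,k+1}L_{i,k-1})>0$. Then such quadrature rules can be chosen with $A_{i,0}=0$ for all $i$ (the upwind condition) if and only if, in each $I_i$, the subdivision points $x_{i,1},\dots,x_{i,k}$ are the $k$ distinct zeros of $$p_i^k=L_{i,k}+\frac{c}{k(1-c)}\,(x-x_{i-\frac12})\,L_{i,k}'$$ for some constant $c<1$.
   Context: $I_i=[x_{i-\frac12},x_{i+\frac12}]$ are the cells of a partition of an interval, $h_i=x_{i+\frac12}-x_{i-\frac12}$, $k\ge1$. Each $I_i$ has subdivision points $x_{i-\frac12}=x_{i,0}<x_{i,1}<\dots<x_{i,k}<x_{i,k+1}=x_{i+\frac12}$. $L_{i,\ell}$ denotes the shifted Legendre polynomial of degree $\ell$ on $I_i$ (the Legendre polynomial $P_\ell$ composed with the affine map of $I_i$ onto $[-1,1]$), so $L_{i,\ell}(x_{i+\frac12})=1$, $L_{i,\ell}(x_{i-\frac12})=(-1)^\ell$ and $\int_{I_i}L_{i,\ell}L_{i,m}\,dx=\delta_{\ell m}h_i/(2\ell+1)$; $L_{i,k}'$ is its derivative. *)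

(* Defs.v *)
From HB Require Import structures.
From mathcomp Require Import all_boot all_order all_algebra.
From mathcomp Require Import all_classical all_reals all_analysis.
Set Implicit Arguments. Unset Strict Implicit. Unset Printing Implicit Defensive.
Import Order.TTheory GRing.Theory Num.Theory.
Import numFieldNormedType.Exports.
Local Open Scope ring_scope.

Section Defs.
Variable R : realType.

(* Legendre polynomial P_l on [-1,1] (Rodrigues' formula). *)
Definition legendre (l : nat) : {poly R} :=
  ((2 ^ l * l`!)%:R)^-1 *: ((('X ^+ 2 - 1) ^+ l)^`(l)).

(* Shifted Legendre polynomial L_l on the cell [a,b]:
   P_l composed with the affine map of [a,b] onto [-1,1]. *)
Definition shifted_legendre (a b : R) (l : nat) : {poly R} :=
  legendre l \Po ((2 / (b - a)) *: 'X - ((a + b) / (b - a))%:P).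

Definition int_poly (a b : R) (v : {poly R}) : R :=
  \int[@lebesgue_measure R]_(x in `[a, b]%classic) v.[x].

Definition quad (k : nat) (A xs : nat -> R) (v : {poly R}) : R :=
  \sum_(j < k.+2) A j * v.[xs j].

Definition quad_ok (k : nat) (a b : R) (A xs : nat -> R) : Prop :=
  (forall v : {poly R}, (size v <= (2 * k)%N)%N -> int_poly a b v = quad k A xs v)
  /\ (b - a) / (2 * k - 1)%:R
       - quad k A xs (shifted_legendre a b k.+1 * shifted_legendre a b k.-1) > 0.

Definition pk (k : nat) (a b c : R) : {poly R} :=
  shifted_legendre a b k
  + (c / (k%:R * (1 - c))) *: (('X - a%:P) * (shifted_legendre a b k)^`()).

End Defs.

(* Main.v *)
(**
The argument is local to a cell [a, b]; write L = L_k, omega = prod_j (x - x_j).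

If A_0 = 0, testing exactness on omega (x - b) q shows that omega is orthogonal
to (x - b) P^{k-2}; integration by parts shows the same for every p^k.  For
alpha = omega(a) / L(a) and 1 - c = alpha lead(L), the difference
omega - alpha p^k has degree < k and vanishes at a, so it equals (x - a) t, and
int (x - a)(x - b) t^2 = 0 forces t = 0.  Since all x_j lie to the right of a,
alpha > 0, that is, c < 1.

Conversely, for k >= 2 testing the given rule on p^k (x - b) yields A_0 = 0, so
that rule already works.  For k = 1 the given weights may have A_0 <> 0, but the
two-point rule on x_1 and b satisfies (1), and (2) as well since L_2(x_1) < 1.
*)
Require Import Defs.
From HB Require Import structures.
From mathcomp Require Import all_boot all_order all_algebra.
From mathcomp Require Import all_classical all_reals all_analysis.
From mathcomp Require Import polyrcf ring lra.
Import Order.TTheory GRing.Theory Num.Theory.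
Import numFieldNormedType.Exports.
Local Open Scope ring_scope.

(** * Integrals of polynomials over a cell *)

Section PolynomialIntegral.
Context {R : realType}.
Implicit Types (a b : R) (p q v : {poly R}).

(** With a polynomial primitive, every integral becomes a difference of endpoint values, so
    linearity below follows from [int_poly_deriv] without integrability side conditions. *)
Lemma poly_primitive v : exists p, p^`() = v.
Proof.
exists (\poly_(i < (size v).+1) (v`_i.-1 / i%:R)).
apply/polyP => i; rewrite coef_deriv coef_poly ltnS.
case: ltnP => [_|le_v_i]; last by rewrite mul0rn nth_default.
by rewrite -[_ *+ _]mulr_natr mulfVK // pnatr_eq0.
Qed.

Context {a b : R} (ltab : a < b).

Lemma int_poly_deriv p : int_poly a b p^`() = p.[b] - p.[a].
Proof.
rewrite /int_poly /Rintegral (@continuous_FTC2 _ _ (horner p)) //.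
- by apply: continuous_subspaceT; exact: continuous_horner.
- split=> //; [exact: cvg_at_right_filter (@continuous_horner _ p a)
              |exact: cvg_at_left_filter (@continuous_horner _ p b)].
- by move=> x _; rewrite derive1E derive_val.
Qed.

Lemma int_polyD p q : int_poly a b (p + q) = int_poly a b p + int_poly a b q.
Proof.
have [P <-] := poly_primitive p; have [Q <-] := poly_primitive q.
by rewrite -derivD !int_poly_deriv !hornerE /=; ring.
Qed.

Lemma int_polyZ (c : R) p : int_poly a b (c *: p) = c * int_poly a b p.
Proof.
have [P <-] := poly_primitive p.
by rewrite -derivZ !int_poly_deriv !hornerE /=; ring.
Qed.

Lemma int_polyB p q : int_poly a b (p - q) = int_poly a b p - int_poly a b q.
Proof. by rewrite int_polyD -scaleN1r int_polyZ mulN1r. Qed.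

Lemma int_poly_by_parts p q :
  p.[a] * q.[a] = 0 -> p.[b] * q.[b] = 0 ->
  int_poly a b (p^`() * q) = - int_poly a b (p * q^`()).
Proof.
move=> pqa pqb; have := int_poly_deriv (p * q).
rewrite derivM int_polyD !hornerM pqa pqb subrr => /eqP.
by rewrite addr_eq0 => /eqP.
Qed.

Lemma poly_eq0_itv p : {in `[a, b], forall x, p.[x] = 0} -> p = 0.
Proof.
(* The values [f n] are pairwise distinct points of the cell, so [p] gets [size p] roots, more than
   its degree allows. *)
move=> p0; pose f n : R := a + (b - a) / n.+1%:R.
apply: (@roots_geq_poly_eq0 _ _ (map f (iota 0 (size p)))).
- apply/allP => _ /mapP[n _ ->]; apply/rootP/p0.
  have ba0 : 0 < b - a by rewrite subr_gt0.
  rewrite in_itv /= lerDl divr_ge0 ?ler0n ?(ltW ba0) //=.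
  by rewrite -lerBrDl ler_pdivrMr // ler_peMr ?(ltW ba0) // ler1n.
- rewrite map_inj_uniq ?iota_uniq // => m n /addrI /mulfI.
  rewrite subr_eq0 (gt_eqF ltab) => /(_ isT)/invr_inj/eqP.
  by rewrite eqr_nat eqSS => /eqP.
- by rewrite size_map size_iota.
Qed.

(** The integrand is nonpositive on the cell, so its primitive [F] is nonincreasing there. Equal
    endpoint values then make [F] constant, and the integrand is the zero polynomial. *)
Lemma int_poly_bump_sqr_eq0 p :
  int_poly a b (('X - a%:P) * ('X - b%:P) * p ^+ 2) = 0 -> p = 0.
Proof.
set g := _ * _; have [F FE] := poly_primitive g.
rewrite -FE int_poly_deriv => /eqP; rewrite subr_eq0 => /eqP Fba.
have mono x y : x \in `[a, b] -> y \in `[a, b] -> x <= y -> F.[y] <= F.[x].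
  move=> xab yab xy; rewrite -lerN2 -!hornerN.
  have Fge0 z : z \in `]a, b[ -> 0 <= (- F)^`().[z].
    rewrite in_itv /= => /andP[az zb]; rewrite derivN FE hornerN oppr_ge0.
    have ge0 : 0 <= (z - a) * (b - z) by rewrite mulr_ge0 // subr_ge0 ltW.
    rewrite /g !hornerE /=; have := mulr_ge0 ge0 (sqr_ge0 p.[z]).
    by rewrite expr2; lra.
  by apply: (@ler_hornerW _ a b).
have Fc x : x \in `[a, b] -> F.[x] = F.[a].
  move=> xab; have /andP[ax xb] : a <= x <= b by rewrite in_itv in xab.
  apply/eqP; rewrite eq_le mono ?in_itv /= ?lexx ?(ltW ltab) //=.
  by rewrite -Fba mono // in_itv /= lexx ltW.
have : F - F.[a]%:P = 0.
  by apply: poly_eq0_itv => x /Fc Fx; rewrite !hornerE Fx subrr.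
move/(congr1 (@deriv R)); rewrite derivB derivC subr0 FE deriv0 => /eqP.
by rewrite mulf_eq0 mulf_eq0 !polyXsubC_eq0 /= mulf_eq0 orbb => /eqP.
Qed.

End PolynomialIntegral.

Lemma size_deriv_leq {R : nzSemiRingType} (p : {poly R}) n :
  (size p <= n.+1)%N -> (size p^`() <= n)%N.
Proof.
move=> szp; apply/leq_sizeP => j lenj.
by rewrite coef_deriv nth_default ?mul0rn // (leq_trans szp).
Qed.

(** * Rodrigues' formula on a cell *)

Section Legendre.
Context {R : realType}.

Lemma derivn_comp_affine (u v : R) (p : {poly R}) n :
  (p \Po (u *: 'X + v%:P))^`(n) = u ^+ n *: (p^`(n) \Po (u *: 'X + v%:P)).
Proof.
elim: n => [|n IHn]; first by rewrite expr0 scale1r !derivn0.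
rewrite !derivnS IHn derivZ deriv_comp derivD derivZ derivX derivC addr0.
by rewrite alg_polyC mulrC mul_polyC scalerA exprSr.
Qed.

Lemma shifted_legendreE (a b : R) l : a < b ->
  shifted_legendre a b l =
    (l`!%:R * (b - a) ^+ l)^-1 *: ((('X - a%:P) * ('X - b%:P)) ^+ l)^`(l).
Proof.
move=> ltab; have ba0 : b - a != 0 by rewrite subr_eq0 gt_eqF.
have lf0 : l`!%:R != 0 :> R by rewrite pnatr_eq0 -lt0n fact_gt0.
rewrite /shifted_legendre /legendre comp_polyZ -polyCN.
set u := 2 / (b - a); set v := - _; set phi := _ + _.
have u0 : u != 0 by rewrite mulf_neq0 ?invr_eq0 ?pnatr_eq0.
have -> : (('X ^+ 2 - 1) ^+ l)^`(l) \Po phi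
    = u ^- l *: ((('X ^+ 2 - 1) ^+ l) \Po phi)^`(l).
  by rewrite derivn_comp_affine scalerA mulVf ?scale1r ?expf_neq0.
have -> : (('X ^+ 2 - 1) ^+ l) \Po phi
    = (u ^+ 2) ^+ l *: (('X - a%:P) * ('X - b%:P)) ^+ l.
  rewrite rmorphXn rmorphB rmorph1 rmorphXn /= comp_polyX -exprZn.
  congr (_ ^+ l); rewrite /phi -!mul_polyC polyC_exp.
  (* This centres the affine map at [b]: [phi] = u(X - b) + 1, so phi^2 - 1 = u(X - b)(u(X - b) +
     2). Since 2 = u(b - a), the last factor is u(X - a). *)
  have -> : v%:P = 1 - u%:P * b%:P.
    by rewrite -polyCM -(polyCB 1) /v /u; congr (_%:P); field.
  have -> : (u%:P * 'X + (1 - u%:P * b%:P)) ^+ 2 - 1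
      = u%:P * ('X - b%:P) * (u%:P * ('X - b%:P) + 2%:P) by ring.
  have -> : 2%:P = u%:P * (b%:P - a%:P).
    by rewrite -polyCB -polyCM /u mulfVK.
  ring.
rewrite derivnZ !scalerA; congr (_ *: _).
rewrite natrM natrX exprAC expr2 -mulrA mulKf ?expf_neq0 // /u expr_div_n.
by field; rewrite lf0 !expf_neq0 // pnatr_eq0.
Qed.

(** For [n] > 0 the surviving power shows that the derivative vanishes at [a]; for [n] = 0 the value
    of the cofactor gives the derivative at [a]. *)
Lemma derivn_XsubC_exp (a : R) m n (g : {poly R}) :
  exists2 q, (('X - a%:P) ^+ (n + m) * g)^`(m) = ('X - a%:P) ^+ n * q
    & q.[a] = ((n + m) ^_ m)%:R * g.[a].
Proof.
elim: m g => [|m IHm] g.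
  by exists g; rewrite ?derivn0 addn0 // ffactn0 mul1r.
(* This is the cofactor of (X - a)^(n+m) after differentiating (X - a)^(n+m+1) g once. *)
have [q E qa] := IHm ((n + m).+1%:R *: g + ('X - a%:P) * g^`()).
exists q.
  rewrite -E derivSn addnS; congr (_^`(m)).
  rewrite derivM deriv_exp derivXsubC mul1r /= -mul_polyC exprS.
  by rewrite -mulr_natl polyC_natr; ring.
by rewrite qa !hornerE subrr mul0r addr0 addnS ffactSS natrM; ring.
Qed.

End Legendre.

(** * Orthogonality, leading coefficients and left endpoint values of L_l and p^k *)

Section LegendreOrthogonality.
Context {R : realType} {a b : R} (ltab : a < b).
Local Notation bump := (('X - a%:P) * ('X - b%:P)).
Local Notation L := (shifted_legendre a b).

Lemma derivn_bump_endpoints m l : (m < l)%N ->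
  (bump ^+ l)^`(m).[a] = 0 /\ (bump ^+ l)^`(m).[b] = 0.
Proof.
move=> ltml; have lE : l = (l - m + m)%N by rewrite subnK // ltnW.
have lm0 : (l - m == 0)%N = false by rewrite subn_eq0 leqNgt ltml.
have van (c : R) p : ((('X - c%:P) ^+ l * p)^`(m)).[c] = 0.
  have [q] := derivn_XsubC_exp c m (l - m) p; rewrite -lE => -> _.
  by rewrite !hornerE subrr expr0n lm0 mul0r.
by rewrite exprMn; split; last rewrite mulrC; apply: van.
Qed.

Lemma shifted_legendre_orth l (q : {poly R}) :
  (size q <= l)%N -> int_poly a b (L l * q) = 0.
Proof.
move=> szq; rewrite shifted_legendreE // -scalerAl int_polyZ //.
(* Each integration by parts moves one of the [m] derivatives onto [p], with no boundary terms
   because fewer than [l] derivatives remain on the power; when none remains, [p] is zero. *)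
suff gen m (p : {poly R}) : (m <= l)%N -> (size p <= m)%N ->
    int_poly a b ((bump ^+ l)^`(m) * p) = 0 by rewrite gen ?mulr0.
elim: m p => [|m IHm] p ltml szp.
  move: szp; rewrite leqn0 size_poly_eq0 => /eqP->.
  by rewrite mulr0 -(scale0r 0) int_polyZ // mul0r.
have [da db] := derivn_bump_endpoints _ _ ltml.
rewrite derivnS (int_poly_by_parts ltab) ?(IHm _ (ltnW ltml)) ?oppr0 //.
- exact: size_deriv_leq.
- by rewrite da mul0r.
- by rewrite db mul0r.
Qed.

Lemma size_bump_exp l : size (bump ^+ l) = (l + l).+1.
Proof.
by rewrite exprMn size_Mmonic ?monic_exp ?monicXsubC ?expf_neq0 ?polyXsubC_eq0
  // !size_exp_XsubC addnS.
Qed.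

Lemma size_shifted_legendre l : (size (L l) <= l.+1)%N.
Proof.
rewrite shifted_legendreE // (leq_trans (size_scale_leq _ _)) //.
apply/leq_sizeP => j ltlj; rewrite coef_derivn nth_default ?mul0rn //.
by rewrite size_bump_exp -addnS leq_add2l.
Qed.

Lemma shifted_legendre_lead_gt0 l : 0 < (L l)`_l.
Proof.
rewrite shifted_legendreE // coefZ coef_derivn.
have : bump ^+ l \is monic by rewrite monic_exp ?monicMl ?monicXsubC.
rewrite monicE lead_coefE size_bump_exp /= => /eqP->.
rewrite mulr_gt0 ?invr_gt0 ?mulr_gt0 ?exprn_gt0 ?subr_gt0 ?ltr0n ?fact_gt0 //.
by rewrite ffact_gt0 leq_addr.
Qed.

(** At [a], all [l] derivatives must fall on (X - a)^l, which leaves l! (a - b)^l before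
    normalisation. *)
Lemma shifted_legendre_left l : (L l).[a] = (-1) ^+ l.
Proof.
rewrite shifted_legendreE // hornerZ exprMn.
have [q] := derivn_XsubC_exp a l 0 (('X - b%:P) ^+ l).
rewrite add0n => -> qa; rewrite expr0 mul1r qa ffactnn !hornerE.
have lf0 : l`!%:R != 0 :> R by rewrite pnatr_eq0 -lt0n fact_gt0.
have h0 : (b - a) ^+ l != 0 by rewrite expf_neq0 // subr_eq0 gt_eqF.
have -> : a - b = -1 * (b - a) by ring.
by rewrite exprMn /=; field; rewrite lf0 h0.
Qed.

Context {k : nat} (k_gt0 : (0 < k)%N).

Lemma size_pk c : (size (pk k a b c) <= k.+1)%N.
Proof.
rewrite (leq_trans (size_polyD _ _)) // geq_max size_shifted_legendre /=.
rewrite (leq_trans (size_scale_leq _ _)) // (leq_trans (size_polyMleq _ _)) //.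
by rewrite size_XsubC add2n /= ltnS size_deriv_leq // size_shifted_legendre.
Qed.

Lemma pk_left c : (pk k a b c).[a] = (-1) ^+ k.
Proof.
rewrite /pk hornerD hornerZ hornerM hornerXsubC subrr mul0r mulr0 addr0.
exact: shifted_legendre_left.
Qed.

(** The top coefficient of (X - a) L' is [k] times that of L, and 1 + c/(1 - c) = 1/(1 - c). *)
Lemma pk_lead c : c < 1 -> (pk k a b c)`_k = (L k)`_k / (1 - c).
Proof.
move=> c1; rewrite coefD coefZ mulrBl coefB coefXM coefCM gtn_eqF //.
rewrite !coef_deriv prednK // [(L k)`_k.+1]nth_default;
  last exact: size_shifted_legendre.
rewrite mul0rn mulr0 subr0 -mulr_natr; field.
by rewrite pnatr_eq0 -lt0n k_gt0 subr_eq0 gt_eqF.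
Qed.

(** Both summands of [pk] are orthogonal separately: L directly, and (X - a) L' after moving the
    derivative onto (X - a)(X - b)q, which vanishes at both ends and whose derivative has degree
    below [k]. *)
Lemma pk_orth c (q : {poly R}) :
  (size q < k)%N -> int_poly a b (pk k a b c * (('X - b%:P) * q)) = 0.
Proof.
move=> szq; rewrite mulrDl int_polyD // -scalerAl int_polyZ //.
have szbq : (size (('X - b%:P) * q)%R <= k)%N.
  by rewrite (leq_trans (size_polyMleq _ _)) // size_XsubC add2n.
rewrite shifted_legendre_orth // add0r.
set p := bump * q.
have -> : ('X - a%:P) * (L k)^`() * (('X - b%:P) * q) = (L k)^`() * p.
  by rewrite /p; ring.
rewrite (int_poly_by_parts ltab) ?shifted_legendre_orth ?oppr0 ?mulr0 //.
- rewrite size_deriv_leq // /p -mulrA.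
  by rewrite (leq_trans (size_polyMleq _ _)) // size_XsubC add2n.
- by rewrite /p !hornerM !hornerXsubC subrr !(mul0r, mulr0).
- by rewrite /p !hornerM !hornerXsubC subrr !(mul0r, mulr0).
Qed.

End LegendreOrthogonality.

Lemma size_leq_lead0 {R : nzRingType} (p : {poly R}) n :
  (size p <= n.+1)%N -> p`_n = 0 -> (size p <= n)%N.
Proof.
move=> /leq_sizeP szp pn0; apply/leq_sizeP => j.
by rewrite leq_eqVlt => /predU1P[<- //|/szp].
Qed.

Lemma prod_XsubC_sign {R : numDomainType} (a : R) (rs : seq R) :
  all (fun z => a < z) rs ->
  0 < (-1) ^+ size rs * (\prod_(z <- rs) ('X - z%:P)).[a].
Proof.
elim: rs => [_|z rs IHrs /= /andP[az /IHrs rs_gt0]].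
  by rewrite big_nil hornerC mulr1 ltr01.
rewrite big_cons hornerM hornerXsubC exprS mulrACA mulr_gt0 //.
by rewrite mulN1r opprB subr_gt0.
Qed.

(** * Nodes and the weight at [a] in a single cell *)

Section Cell.
Context {R : realType} {k : nat} {a b : R} {x : nat -> R}.
Hypotheses (k_gt0 : (0 < k)%N) (ltab : a < b).
Hypotheses (x0 : x 0%N = a) (xk1 : x k.+1 = b).
Hypothesis x_incr : forall j, (j <= k)%N -> x j < x j.+1.

Let x_lt i j : (i < j <= k.+1)%N -> x i < x j.
Proof.
elim: j => // j IHj /andP[]; rewrite !ltnS leq_eqVlt => /predU1P[->|ltij] lejk.
  exact: x_incr.
by rewrite (lt_trans _ (x_incr _ lejk)) // IHj // ltij leqW.
Qed.

Lemma radau_nodes (A : nat -> R) :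
  A 0%N = 0 ->
  (forall v : {poly R}, (size v <= (2 * k)%N)%N ->
     int_poly a b v = quad k A x v) ->
  exists c : R, c < 1 /\
    (forall y : R, root (pk k a b c) y <->
       exists2 j : nat, (1 <= j <= k)%N & y = x j).
Proof.
move=> A0 exactA; pose rs := [seq x j | j <- iota 1 k].
pose om := \prod_(z <- rs) ('X - z%:P).
have szrs : size rs = k by rewrite size_map size_iota.
have szom : size om = k.+1 by rewrite size_prod_XsubC szrs.
have omk : om`_k = 1.
  have := monic_prod_XsubC rs xpredT id.
  by rewrite monicE lead_coefE szom => /eqP.
have rootom y : root om y <-> exists2 j, (1 <= j <= k)%N & y = x j.
  rewrite root_prod_XsubC; split.
    by case/mapP=> j; rewrite mem_iota add1n ltnS => jk ->; exists j.
  case=> j jk ->; apply/mapP; exists j => //.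
  by rewrite mem_iota add1n ltnS.
have om_orth (q : {poly R}) :
    (size q < k)%N -> int_poly a b (om * (('X - b%:P) * q)) = 0.
  move=> szq; rewrite exactA.
    (* Every term of the rule is zero: the one at [a] by its weight, the one at [b] by the factor X
       - b, the others by [om]. *)
    rewrite /quad big1 // => -[[|j] ltj] _ /=; first by rewrite A0 mul0r.
    rewrite !hornerM hornerXsubC.
    move: ltj; rewrite !ltnS leq_eqVlt => /predU1P[->|ltjk].
      by rewrite xk1 subrr mul0r !mulr0.
    have /rootom/rootP-> : exists2 i, (1 <= i <= k)%N & x j.+1 = x i.
      by exists j.+1.
    by rewrite mul0r mulr0.
  rewrite (leq_trans (size_polyMleq _ _)) // szom addSn /=.
  rewrite mul2n -addnn leq_add2l (leq_trans (size_polyMleq _ _)) //.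
  by rewrite size_XsubC add2n.
(* This is om(a)/L(a), since L(a) = (-1)^k is its own inverse; it makes [om] and [al *: pk k a b c]
   agree at [a]. *)
pose al := (-1) ^+ k * om.[a].
have al_gt0 : 0 < al.
  rewrite /al -szrs prod_XsubC_sign //; apply/allP => z /mapP[j].
  rewrite mem_iota add1n ltnS => /andP[j1 jk] ->.
  by rewrite -x0 x_lt // j1 leqW.
have l_gt0 := shifted_legendre_lead_gt0 ltab k.
(* Solves al lead(L)/(1 - c) = 1, so that [al *: pk k a b c] has leading coefficient 1 like [om]. *)
pose c := 1 - al * (shifted_legendre a b k)`_k.
have c1 : c < 1 by rewrite ltrBlDr ltrDl mulr_gt0.
exists c; split=> // y; rewrite -rootom.
suff -> : om = al *: pk k a b c by rewrite rootZ ?gt_eqF.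
apply/eqP; rewrite -subr_eq0; set r := om - _.
have szr : (size r <= k)%N.
  apply: size_leq_lead0.
    rewrite (leq_trans (size_polyD _ _)) // size_polyN geq_max szom leqnn /=.
    by rewrite (leq_trans (size_scale_leq _ _)) // size_pk.
  rewrite coefB coefZ omk pk_lead //.
  have -> : 1 - c = al * (shifted_legendre a b k)`_k by rewrite /c; ring.
  by field; rewrite !gt_eqF.
have /factor_theorem[t rE] : root r a.
  apply/rootP; rewrite hornerD hornerN hornerZ pk_left // /al mulrAC -expr2.
  by rewrite sqrr_sign mul1r subrr.
have [t0|t0] := eqVneq t 0; first by rewrite rE t0 mul0r.
have szt : (size t < k)%N.
  by move: szr; rewrite rE size_Mmonic ?monicXsubC // size_XsubC addn2.
(* The integrand is [r] times (X - b)t, and both [om] and [pk] are orthogonal to (X - b)t because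
   [t] has degree at most [k] - 2. *)
have : int_poly a b (('X - a%:P) * ('X - b%:P) * t ^+ 2) = 0.
  have -> : ('X - a%:P) * ('X - b%:P) * t ^+ 2 = r * (('X - b%:P) * t).
    by rewrite rE; ring.
  by rewrite mulrBl -scalerAl int_polyB // int_polyZ // om_orth // pk_orth //
    mulr0 subrr.
by move/(int_poly_bump_sqr_eq0 ltab)/eqP; rewrite (negPf t0).
Qed.

(** The test polynomial p^k (X - b) vanishes at every node except [a], where its value (-1)^k (a -
    b) is nonzero. Its integral is zero by [pk_orth] with q = 1, which is admissible only for [k] >
    1. *)
Lemma radau_weight0 (A : nat -> R) (c : R) :
  (1 < k)%N -> (forall y : R, root (pk k a b c) y <->
       exists2 j : nat, (1 <= j <= k)%N & y = x j) ->
  (forall v : {poly R}, (size v <= (2 * k)%N)%N ->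
     int_poly a b v = quad k A x v) ->
  A 0%N = 0.
Proof.
move=> k_gt1 rootp exactA.
have := pk_orth (k := k) ltab c 1; rewrite size_poly1 mulr1 => /(_ k_gt1).
rewrite exactA.
  rewrite /quad big_ord_recl /= big1 => [|[j ltj] _].
    rewrite addr0 hornerM x0 pk_left // hornerXsubC => /eqP.
    rewrite !mulf_eq0 signr_eq0 subr_eq0 (lt_eqF ltab) !orbF.
    by move/eqP.
  rewrite /= /bump /= add1n hornerM hornerXsubC.
  move: ltj; rewrite ltnS leq_eqVlt => /predU1P[->|ltjk].
    by rewrite xk1 subrr !mulr0.
  have /rootp/rootP-> : exists2 i, (1 <= i <= k)%N & x j.+1 = x i.
    by exists j.+1.
  by rewrite mul0r mulr0.
rewrite (leq_trans (size_polyMleq _ _)) // size_XsubC addn2 /=.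
rewrite (leq_ltn_trans (size_pk ltab c)) // mul2n -addnn.
by rewrite -[k.+2]addn2 leq_add2l.
Qed.

End Cell.

(** * The two-point rule for [k] = 1 *)

Lemma shifted_legendre0 {R : realType} (a b : R) : a < b ->
  shifted_legendre a b 0 = 1.
Proof.
by move=> ltab; rewrite shifted_legendreE // !expr0 derivn0 mulr1 invr1 scale1r.
Qed.

(** This form of L_2 shows at once that it is below 1 inside the cell and equal to 1 at [b]. It
    comes from (p + q)^2 = (b - a)^2 + 4pq for p = y - a, q = y - b. *)
Lemma shifted_legendre2 {R : realType} (a b y : R) : a < b ->
  (shifted_legendre a b 2).[y] = 1 + 6 * (y - a) * (y - b) / (b - a) ^+ 2.
Proof.
move=> ltab; have ba0 : b - a != 0 by rewrite subr_eq0 gt_eqF.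
have deriv2 (p q : {poly R}) : p^`() = 1 -> q^`() = 1 ->
    (((p * q) ^+ 2)^`())^`() = 2 * (p + q) ^+ 2 + 4 * (p * q).
  move=> dp dq; have dpq : (p * q)^`() = p + q by rewrite derivM dp dq; ring.
  rewrite expr2 derivM dpq derivD !(derivM (p + q), derivM _ (p + q)).
  by rewrite !derivD dp dq dpq; ring.
rewrite shifted_legendreE // hornerZ derivnS derivn1 deriv2 ?derivXsubC //.
rewrite -!polyC_natr !hornerE (_ : 2`! = 2)%N //=.
by field.
Qed.

Lemma radau_two_point {R : realType} (a b : R) (x : nat -> R) :
  x 0%N = a -> x 2%N = b -> a < x 1%N < b ->
  exists2 A : nat -> R, A 0%N = 0 & quad_ok 1 a b A x.
Proof.
move=> x0 x2 /andP[ax xb]; have ltab := lt_trans ax xb.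
(* Exactness on constants forces the weights to sum to [b - a]; exactness on the identity then
   determines [w1]. *)
pose w1 := (b - a) ^+ 2 / (2 * (b - x 1%N)).
have w1_gt0 : 0 < w1 by rewrite divr_gt0 ?exprn_gt0 ?mulr_gt0 ?subr_gt0.
pose A j := if j is j'.+1 then (if j' is 0 then w1 else b - a - w1) else 0 : R.
exists A => //; split=> [v szv|].
  have -> : v = ((v`_0)%:P * 'X + (v`_1 / 2)%:P * 'X ^+ 2)^`().
    rewrite !poly.derivE /=; apply/polyP => -[|[|i]];
      rewrite !coefE /=; last first.
    by rewrite nth_default ?(leq_trans szv) // mul0rn !mulr0 addr0.
    by field.
    by field.
  rewrite int_poly_deriv // /quad !big_ord_recl big_ord0 /= /bump /= x0 x2.
  rewrite !poly.derivE !hornerE /= /w1; field.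
  by rewrite subr_eq0 gt_eqF.
rewrite shifted_legendre0 // mulr1 /quad !big_ord_recl big_ord0 /= /bump /= x2.
rewrite !shifted_legendre2 //; set y := x 1%N in ax xb w1_gt0 *.
have -> : (b - a) / (2 * 1 - 1)%:R = b - a by rewrite divr1.
have ba0 : 0 < b - a by rewrite subr_gt0.
have W_gt0 : 0 < w1 * ((y - a) * (b - y) / (b - a) ^+ 2).
  by rewrite !(mulr_gt0, invr_gt0, exprn_gt0, subr_gt0).
set S := (X in 0 < X).
(* As L_0 = 1 and L_2(b) = 1, the gap in the second condition reduces to w1 (1 - L_2(y)). *)
suff -> : S = 6 * (w1 * ((y - a) * (b - y) / (b - a) ^+ 2)) by rewrite mulr_gt0.
by rewrite /S; field; rewrite gt_eqF.
Qed.

(** * From single cells to the whole partition *)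

Theorem theorem4p27 (R : realType) (N k : nat) (X : nat -> R)
  (s : nat -> nat -> R)
  (hk : (1 <= k)%N)
  (hX : forall i, (i < N)%N -> X i < X i.+1)
  (hs0 : forall i, (i < N)%N -> s i 0%N = X i)
  (hsk : forall i, (i < N)%N -> s i k.+1 = X i.+1)
  (hs : forall i j, (i < N)%N -> (j <= k)%N -> s i j < s i j.+1)
  (hQ : exists A : nat -> nat -> R,
          forall i, (i < N)%N -> quad_ok k (X i) (X i.+1) (A i) (s i)) :
  (exists A : nat -> nat -> R,
     forall i, (i < N)%N ->
       A i 0%N = 0 /\ quad_ok k (X i) (X i.+1) (A i) (s i))
  <->
  (forall i, (i < N)%N ->
     exists c : R, c < 1 /\
       (forall x : R, root (pk k (X i) (X i.+1) c) x <->
          exists2 j : nat, (1 <= j <= k)%N & x = s i j)).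
Proof.
have s_lt i : (i < N)%N -> forall j, (j <= k)%N -> s i j < s i j.+1.
  by move=> iN j; exact: hs.
split=> [[A okA] i iN|nodes].
  have [A0 [exactA _]] := okA i iN.
  exact: radau_nodes hk (hX i iN) (hs0 i iN) (hsk i iN) (s_lt i iN) _ A0 exactA.
have [A okA] := hQ.
(* The bound on [i] sits under the existential so that [choice] applies to all naturals; beyond [N]
   any weights serve. *)
suff /choice[A' okA'] i : exists A', (i < N)%N ->
    A' 0%N = 0 /\ quad_ok k (X i) (X i.+1) A' (s i) by exists A'.
have [iN|_] := boolP (i < N)%N; last by exists (A i).
have [k_gt1|k_le1] := ltnP 1 k.
  exists (A i) => _; split; last exact: okA.
  have [c [_ rootp]] := nodes i iN; have [exactA _] := okA i iN.
  exact: radau_weight0 (hX i iN) (hs0 i iN) (hsk i iN) _ _ k_gt1 rootp exactA.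
have k1 : k = 1%N by apply/eqP; rewrite eqn_leq k_le1.
have xin : X i < s i 1%N < X i.+1.
  by rewrite -(hs0 i iN) -(hsk i iN) k1 !s_lt ?k1.
have s2 : s i 2%N = X i.+1 by rewrite -(hsk i iN) k1.
have [A' A'0 okA'] := radau_two_point _ _ _ (hs0 i iN) s2 xin.
by exists A'; rewrite k1.
Qed.
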